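(* Let $\Sigma\in\mathcal{G}_n$ and let $Q_0$ be the unique regular rational orthogonal matrix with $Q_0^{\rm T}S(\Sigma)Q_0=S(\Sigma^{\rm T})$, with level $\ell_0$. Suppose that $\ell_0=p_1p_2\cdots p_t$, where the $p_i$ are distinct odd primes, for some $t\ge 0$. Then, up to isomorphism, the number of generalized cospectral mates of $\Sigma$ is at most $2^t-1$.
   Context: An oriented graph $\Sigma$ on vertices $v_1,\dots,v_n$ is a simple graph each of whose edges is given a direction. Its skew-adjacency matrix $S(\Sigma)=(s_{ij})$ has $s_{ij}=1$ if $(v_i,v_j)$ is an arc, $s_{ij}=-1$ if $(v_j,v_i)$ is an arc, and $s_{ij}=0$ otherwise. The converse $\Sigma^{\rm T}$ is obtained by reversing every arc, so $S(\Sigma^{\rm T})=-S(\Sigma)$. Two oriented graphs $\Sigma,\Delta$ are isomorphic if $S(\Delta)=P^{\rm T}S(\Sigma)P$ for some permutation matrix $P$. They are generalized cospectral if $S(\Sigma)$ and $S(\Delta)$ have the same spectrum and $J-I-S(\Sigma)$ and $J-I-S(\Delta)$ have the same spectrum ($J$ the all-one matrix, $I$ the identity). A generalized cospectral mate of $\Sigma$ is an oriented graph that is generalized cospectral with $\Sigma$ but not isomorphic to $\Sigma$. Let $e$ be the all-one vector and $W(\Sigma)=[e,Se,\dots,S^{n-1}e]$ with $S=S(\Sigma)$ (the skew-walk matrix). $\mathcal{G}_n$ is the set of all $n$-vertex oriented graphs $\Sigma$ such that $2^{-\lfloor n/2\rfloor}\det W(\Sigma)$ is an odd square-free integer. A rational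 orthogonal matrix $Q$ is regular if $Qe=e$; its level is the smallest positive integer $k$ such that $kQ$ is integral. For $\Sigma$ with $\det W(\Sigma)\neq0$ and any $\Delta$ generalized cospectral with $\Sigma$ there is a unique regular rational orthogonal $Q$ with $Q^{\rm T}S(\Sigma)Q=S(\Delta)$; in particular $Q_0$ above is well defined. *)

(* Defs.v *)
From HB Require Import structures.
From mathcomp Require Import all_boot all_order all_fingroup all_algebra.
Set Implicit Arguments. Unset Strict Implicit. Unset Printing Implicit Defensive.
Import Order.TTheory GRing.Theory Num.Theory.
Local Open Scope ring_scope.

(* An oriented graph on n vertices, given by its skew-adjacency matrix. *)
Definition oriented_graph (n : nat) (S : 'M[int]_n) : Prop :=
  forall i j : 'I_n, S j i = - S i j /\ S i j \in [:: 0; 1; -1].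

Definition onevec (n : nat) : 'cV[int]_n := const_mx 1.
Definition Jmx (n : nat) : 'M[int]_n := const_mx 1.

Definition oriso (n : nat) (S D : 'M[int]_n) : Prop :=
  exists s : 'S_n, D = (perm_mx s)^T *m S *m perm_mx s.

(* Same spectrum (with multiplicities) = same characteristic polynomial. *)
Definition gen_cospectral (n : nat) (S D : 'M[int]_n) : Prop :=
  char_poly S = char_poly D /\
  char_poly (Jmx n - 1%:M - S) = char_poly (Jmx n - 1%:M - D).

Definition gc_mate (n : nat) (S D : 'M[int]_n) : Prop :=
  oriented_graph D /\ gen_cospectral S D /\ ~ oriso S D.

Definition walk_mx (n : nat) (S : 'M[int]_n) : 'M[int]_n :=
  \matrix_(i < n, j < n) (iter j (mulmx S) (onevec n)) i ord0.

Definition squarefree_nat (m : nat) : Prop :=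
  forall k : nat, (1 < k)%N -> ~~ (k ^ 2 %| m)%N.

Definition in_Gn (n : nat) (S : 'M[int]_n) : Prop :=
  exists q : int, \det (walk_mx S) = q * (2 ^ n./2)%:R /\
                  odd `|q|%N /\ squarefree_nat `|q|%N.

Definition rat_mx (m n : nat) (S : 'M[int]_(m, n)) : 'M[rat]_(m, n) := map_mx intr S.

Definition reg_rat_orth (n : nat) (Q : 'M[rat]_n) : Prop :=
  Q^T *m Q = 1%:M /\ Q *m rat_mx (onevec n) = rat_mx (onevec n).

Definition integral_mx (n : nat) (Q : 'M[rat]_n) : Prop :=
  exists M : 'M[int]_n, Q = rat_mx M.

Definition is_level (n : nat) (Q : 'M[rat]_n) (k : nat) : Prop :=
  (0 < k)%N /\ integral_mx (k%:R *: Q) /\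
  forall k' : nat, (0 < k')%N -> integral_mx (k'%:R *: Q) -> (k <= k')%N.

(* Main.v *)
Require Import Defs.
From HB Require Import structures.
From mathcomp Require Import all_boot all_order all_fingroup all_algebra.
From mathcomp Require Import ring lra zify.
Import Order.TTheory GRing.Theory Num.Theory.
Local Open Scope ring_scope.
Set Implicit Arguments. Unset Strict Implicit. Unset Printing Implicit Defensive.

(** The orthogonal matrix attached to a generalized cospectral D is (the
transpose of) W(D) W(S)^-1, and two such matrices that differ by an integral one give
isomorphic graphs, so the matter is to decide integrality one prime at a time.
- At 2, chi_S is modulo 2 a square (times x for odd n), and its root f kills e
  modulo 2; dividing the last columns f(S) S^k e of the walk matrix by 2 turns
  it into a matrix of odd determinant, by the same rule for S and D.
- At an odd p dividing det W(S) exactly once, the lattices Z^n and Q Z^n both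
  contain the walk lattice with index p, and the discriminant form, a plane over
  F_p, has at most two isotropic lines: hence at most one lattice Q Z^n differs
  from Z^n.
- If that second lattice exists, the reversal Q0 has to exchange the two: if it
  fixed them, S would act as 0 on the discriminant plane, which is a cyclic
  F_p[S]-module of dimension 2. So p divides the level of Q0.
A mate is thus determined up to isomorphism by the set of p_i at which its
matrix is not integral, and this set is nonempty. *)

(** * Rational numbers localized at a prime *)

(* For p prime, the localization of the integers at p; "x is 0 modulo p" is then
   expressed by x / p \in zloc p. *)
Definition zloc (p : nat) : {pred rat} := fun x => coprime p `|denq x|.

Lemma zlocP p x :
  reflect (exists k m : int, coprime p `|k| /\ x * k%:~R = m%:~R) (x \in zloc p).
Proof.
apply: (iffP idP) => [px | [k [m [pk xk]]]].
  by exists (denq x), (numq x); rewrite numqE.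
have k0 : k != 0 \/ k = 0 by case: eqVneq; [right|left].
case: k0 => [k0|k0]; last first.
  (* [coprime p 0] holds only for p = 1, and then every rational belongs to [zloc p]. *)
  have p1 : p = 1%N by move: pk; rewrite k0 /coprime gcdn0 => /eqP.
  by rewrite unfold_in p1 coprime1n.
have kd : (denq x %| k)%Z.
  have : (denq x %| numq x * k)%Z.
    apply/dvdzP; exists m; apply: (@intr_inj rat).
    by rewrite !intrM numqE -xk mulrAC.
  by rewrite Gauss_dvdzr // coprimez_sym; exact: coprime_num_den.
rewrite unfold_in; apply: coprime_dvdr pk; exact: kd.
Qed.

Fact zloc_subring p : GRing.subring_closed (zloc p).
Proof.
split.
- by apply/zlocP; exists 1, 1; rewrite coprimen1 mulr1.
- move=> x y /zlocP[k [a [pk xk]]] /zlocP[l [b [pl yl]]]; apply/zlocP.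
  exists (k * l), (a * l - b * k); rewrite abszM coprimeMr pk pl.
  by split=> //; rewrite rmorphB !rmorphM /= -xk -yl; ring.
- move=> x y /zlocP[k [a [pk xk]]] /zlocP[l [b [pl yl]]]; apply/zlocP.
  exists (k * l), (a * b); rewrite abszM coprimeMr pk pl.
  by split=> //; rewrite !rmorphM /= -xk -yl; ring.
Qed.
HB.instance Definition _ p := GRing.isSubringClosed.Build rat (zloc p) (zloc_subring p).

Lemma zloc_int p (m : int) : m%:~R \in zloc p.
Proof. exact: rpred_int. Qed.

Lemma zlocV_int p (k : int) : coprime p `|k| -> (k%:~R)^-1 \in zloc p.
Proof.
have [->|k0] := eqVneq k 0; first by rewrite invr0 rpred0.
by move=> pk; apply/zlocP; exists k, 1; rewrite mulVf // intr_eq0.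
Qed.

(** Either p divides the numerator, or numerator and denominator may be exchanged: [zloc p] is a
    valuation ring with uniformizer p. *)
Lemma zloc_prime_dichotomy p x : prime p -> x \in zloc p ->
  x / p%:R \in zloc p \/ x^-1 \in zloc p.
Proof.
move=> pp px; have [pn|pn] := boolP (p %| `|numq x|)%N; [left | right].
  case/dvdnP: pn => k nk.
  have -> : x / p%:R = (sgz (numq x) * k)%:~R / (denq x)%:~R.
    rewrite -[x in LHS]divq_num_den; apply: (canLR (mulfK _)).
      by rewrite pnatr_eq0 -lt0n prime_gt0.
    rewrite mulrAC; congr (_ / _).
    by rewrite {1}(intEsg (numq x)) nk !intrM PoszM !intrM mulrA.
  by rewrite rpredM ?zloc_int // zlocV_int.
rewrite -[x]divq_num_den invf_div rpredM ?zloc_int // zlocV_int //.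
by rewrite prime_coprime.
Qed.

Lemma zloc_invp p : prime p -> (p%:R)^-1 \notin zloc p.
Proof.
move=> pp; rewrite unfold_in -[p%:R]/((Posz p)%:~R) denqVz; last first.
  by rewrite eqz_nat -lt0n prime_gt0.
by rewrite prime_coprime // dvdnn.
Qed.

(** An [x] that p does not divide is a unit of [zloc p], so it cancels modulo p. *)
Lemma zloc_cancel p (x y : rat) : prime p -> x \in zloc p -> x / p%:R \notin zloc p ->
  x * y / p%:R \in zloc p -> y / p%:R \in zloc p.
Proof.
move=> pp px pxn pxy.
have x0 : x != 0 by apply: contraNneq pxn => ->; rewrite mul0r rpred0.
have xV : x^-1 \in zloc p by case: (zloc_prime_dichotomy pp px) => // /(negP pxn).
by rewrite -(mulKf x0 y) -mulrA rpredM.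
Qed.

Lemma zloc_halve p (x : rat) : prime p -> odd p -> 2%:R * x / p%:R \in zloc p ->
  x / p%:R \in zloc p.
Proof.
move=> pp po; apply: zloc_cancel => //; first exact: (zloc_int p 2).
apply/negP => p2; have p2o: coprime p 2 by rewrite coprimen2.
have := zlocV_int (k := 2) p2o => h; have := rpredM h p2.
rewrite mulKf //; exact/negP/zloc_invp.
Qed.

Lemma zloc_all_int x : (forall p, prime p -> x \in zloc p) -> denq x = 1.
Proof.
move=> zx; have [d1|d1] := leqP `|denq x| 1.
  have := absz_denq x; have := denq_gt0 x; move: d1; case: `|denq x|%N => [|[|]] //.
  by move=> _ + h; rewrite -h.
have pp := pdiv_prime d1; have := zx _ pp.
by rewrite unfold_in prime_coprime // pdiv_dvd.
Qed.

(** * Determinants: matrices over a subring, rank-one updates *)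

Lemma mxOver_tr (R : Type) (m n : nat) (S : {pred R}) (A : 'M[R]_(m, n)) :
  (A^T \is a mxOver S) = (A \is a mxOver S).
Proof.
by apply/mxOverP/mxOverP => h i j; have := h j i; rewrite mxE.
Qed.

Lemma mxOver_rat p m n (A : 'M[int]_(m, n)) : rat_mx A \is a mxOver (zloc p).
Proof. by apply/mxOverP => i j; rewrite mxE zloc_int. Qed.

Lemma mxOver_det (R : comPzRingType) (S : subringClosed R) n (A : 'M[R]_n) :
  A \is a mxOver S -> \det A \in S.
Proof.
move=> /mxOverP hA; apply: rpred_sum => s _; rewrite rpredMsign.
by apply: rpred_prod => i _.
Qed.

Lemma mxOver_row_det (R : comPzRingType) (S : subringClosed R) n (A : 'M[R]_n) c (i0 : 'I_n) :
  (forall i j, i != i0 -> A i j \in S) -> (forall j, c * A i0 j \in S) ->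
  c * \det A \in S.
Proof.
move=> hA h0; rewrite (expand_det_row _ i0) mulr_sumr; apply: rpred_sum => j _.
rewrite mulrA rpredM // rpredMsign mxOver_det //; apply/mxOverP => i k.
by rewrite !mxE hA // eq_sym neq_lift.
Qed.

(** Clearing [u] in the bordered matrix [B] by column operations gives \det B = \det (M - v u).
    Clearing [v] with the help of [\adj M] multiplies \det B by \det M and yields the right-hand
    side times \det M, which cancels. *)
Lemma det_sub_rank1 (R : idomainType) n (M : 'M[R]_n) (v : 'cV[R]_n) (u : 'rV[R]_n) :
  \det M != 0 -> \det (M - v *m u) = \det M - (u *m \adj M *m v) 0 0.
Proof.
move=> M0; pose B : 'M_(1 + n) := block_mx 1%:M u v M.
have detB : \det B = \det (M - v *m u).
  have := det_mulmx B (block_mx 1%:M (- u) 0 1%:M).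
  rewrite det_ublock !det1 !mulr1 => <-.
  rewrite mulmx_block !mulmx1 !mulmx0 !mul1mx !addr0 addNr det_lblock det1 mul1r.
  by rewrite mulmxN addrC.
have := det_mulmx B (block_mx (\det M)%:M 0 (- \adj M *m v) 1%:M).
rewrite det_lblock det_scalar1 det1 mulr1 mulmx_block !mulmx1 !mulmx0 !mul1mx !add0r.
rewrite mulNmx !mulmxN !mulmxA mul_mx_adj mul_scalar_mx mul_mx_scalar subrr.
rewrite det_ublock detB det_mx11 mulrC [RHS]mulrC => /(mulfI M0) <-.
by rewrite !mxE eqxx mulr1n.
Qed.

(** * Walk counts and the two spectra *)

Section Walks.
Variables (R : comNzRingType) (n : nat).
Implicit Types (A : 'M[R]_n).

Definition walk_vec A k : 'cV[R]_n := iter k (mulmx A) (const_mx 1).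
Definition walk_count A k : R := ((const_mx 1 : 'rV_n) *m walk_vec A k) 0 0.

Lemma walk_vecS A k : walk_vec A k.+1 = A *m walk_vec A k.
Proof. by []. Qed.

(** The coefficient of X^(m-1-k) is [walk_count A k]: this is the polynomial part of X^m e^T (X -
    A)^-1 e. *)
Fixpoint walk_poly A m : {poly R} :=
  if m is k.+1 then 'X * walk_poly A k + (walk_count A k)%:P else 0.

Fixpoint walk_poly_vec A m : 'cV[{poly R}]_n :=
  if m is k.+1 then 'X *: walk_poly_vec A k + map_mx polyC (walk_vec A k) else 0.

Lemma walk_poly_vecE A m :
  ((const_mx 1 : 'rV_n) *m walk_poly_vec A m) 0 0 = walk_poly A m.
Proof.
elim: m => [|m IH] /=; first by rewrite mulmx0 mxE.
rewrite mulmxDr -scalemxAr mxE; congr (_ + _); first by rewrite mxE IH.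
rewrite mxE.
rewrite /walk_count mxE rmorph_sum; apply: eq_bigr => i _ /=.
by rewrite !mxE rmorphM.
Qed.

(** A truncated Neumann series: the sum of X^(m-1-k) A^k e over k < m telescopes under X - A. *)
Lemma resolvent_walk A m : char_poly_mx A *m walk_poly_vec A m =
  'X^m *: const_mx 1 - map_mx polyC (walk_vec A m).
Proof.
elim: m => [|m IH] /=.
  by rewrite mulmx0 expr0 scale1r map_const_mx subrr.
rewrite mulmxDr -scalemxAr IH scalerBr scalerA -exprS.
rewrite /char_poly_mx mulmxBl -map_mxM mul_scalar_mx.
by rewrite addrA subrK.
Qed.

End Walks.

Lemma size_det_le (R : comNzRingType) n (M : 'M[{poly R}]_n) :
  (forall i j, size (M i j) <= 2)%N -> (size (\det M) <= n.+1)%N.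
Proof.
move=> hM; apply: (leq_trans (size_sum _ _ _)); apply/bigmax_leqP => s _.
rewrite size_Msign; apply: (leq_trans (size_poly_prod_leq _ _)).
rewrite leq_subLR cardT size_enum_ord addnS ltnS.
apply: (@leq_trans (\sum_(i < n) 2)%N); first by apply: leq_sum => i _; apply: hM.
by rewrite sum_nat_const card_ord muln2 addnn.
Qed.

(** Multiplying [resolvent_walk] on the left by e^T adj(X - A) exhibits [walk_poly A m] as a
    Euclidean quotient by [char_poly A], with remainder e^T adj(X - A) A^m e. *)
Lemma walk_poly_division (R : comNzRingType) n (A : 'M[R]_n) m :
  exists2 r : {poly R}, (size r <= n)%N &
  'X^m * ((const_mx 1 : 'rV_n) *m \adj (char_poly_mx A) *m (const_mx 1 : 'cV_n)) 0 0
    = char_poly A * walk_poly A m + r.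
Proof.
exists (((const_mx 1 : 'rV_n) *m \adj (char_poly_mx A) *m
   map_mx polyC (walk_vec A m)) 0 0).
  rewrite -mulmxA mxE; apply: (leq_trans (size_sum _ _ _)); apply/bigmax_leqP => i _.
  rewrite mxE mul1r mxE; apply: (leq_trans (size_sum _ _ _)); apply/bigmax_leqP => j _.
  rewrite [X in _ * X]mxE mulrC mul_polyC; apply: (leq_trans (size_scale_leq _ _)).
  (* A cofactor is a determinant of order n - 1, whence the bound n rather than n + 1. *)
  rewrite mxE size_Msign -[X in (_ <= X)%N](ltn_predK (ltn_ord i)).
  apply: size_det_le => k l; rewrite !mxE.
  apply: (leq_trans (size_polyD _ _)); rewrite geq_max size_polyN size_polyC.
  rewrite (leq_trans (leq_b1 _)) // andbT.
  by case: (_ == _); rewrite ?mulr1n ?size_polyX ?mulr0n ?size_poly0.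
have := congr1 (mulmx ((const_mx 1 : 'rV_n) *m \adj (char_poly_mx A))) (resolvent_walk A m).
rewrite mulmxA -[X in X *m _ = _]mulmxA mul_adj_mx mul_mx_scalar -scalemxAl.
rewrite mulmxBr -scalemxAr => /(congr1 (fun M : 'M_1 => M 0 0)).
rewrite mxE walk_poly_vecE.
set P := (_ *m _ *m const_mx 1); set Q := (_ *m _ *m map_mx _ _).
by rewrite !mxE /char_poly => ->; rewrite subrK.
Qed.

(** Uniqueness of the quotient by a monic polynomial of degree n: a nonzero difference of quotients
    would make a nonzero multiple of [char_poly A] have degree below n. *)
Lemma walk_poly_uniq (R : idomainType) n (A B : 'M[R]_n) m :
  char_poly A = char_poly B ->
  ((const_mx 1 : 'rV_n) *m \adj (char_poly_mx A) *m (const_mx 1 : 'cV_n)) 0 0 =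
  ((const_mx 1 : 'rV_n) *m \adj (char_poly_mx B) *m (const_mx 1 : 'cV_n)) 0 0 ->
  walk_poly A m = walk_poly B m.
Proof.
move=> eqAB eqN; have [r sr er] := walk_poly_division A m.
have [r' sr' er'] := walk_poly_division B m.
have e : char_poly A * (walk_poly A m - walk_poly B m) = r' - r.
  move: er; rewrite eqN er' -eqAB => /eqP; rewrite -subr_eq => /eqP h.
  by rewrite mulrBr -h; ring.
apply/eqP; rewrite -subr_eq0; apply/negPn/negP => nz.
have : (size (char_poly A * (walk_poly A m - walk_poly B m))%R <= n)%N.
  rewrite e; apply: (leq_trans (size_polyD _ _)).
  by rewrite size_polyN geq_max sr sr'.
rewrite mulrC size_Mmonic ?char_poly_monic // size_char_poly addnS /= leqNgt.
by rewrite -size_poly_gt0 in nz; rewrite -[X in (X < _)%N]add0n ltn_add2r nz.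
Qed.

Lemma walk_count_uniq (R : idomainType) n (A B : 'M[R]_n) k :
  char_poly A = char_poly B ->
  ((const_mx 1 : 'rV_n) *m \adj (char_poly_mx A) *m (const_mx 1 : 'cV_n)) 0 0 =
  ((const_mx 1 : 'rV_n) *m \adj (char_poly_mx B) *m (const_mx 1 : 'cV_n)) 0 0 ->
  walk_count A k = walk_count B k.
Proof.
move=> eqAB eqN; have := walk_poly_uniq k.+1 eqAB eqN.
move=> /(congr1 (fun q : {poly R} => q`_0)) /=.
by rewrite !coefD !coefXM !coefC /= !add0r.
Qed.

Definition skewsym n (A : 'M[int]_n) := A^T = - A.

(** At X - 1 the characteristic matrix of J - I - S becomes X - J + S, whose transpose is X - S - e
    e^T by skew symmetry: a rank-one update. The two spectra therefore determine e^T adj(X - S)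
    e. *)
Lemma skew_complement_char_poly n (S : 'M[int]_n) : skewsym S ->
  char_poly (Jmx n - 1%:M - S) \Po ('X - 1) = char_poly S -
  ((const_mx 1 : 'rV_n) *m \adj (char_poly_mx S) *m (const_mx 1 : 'cV_n)) 0 0.
Proof.
move=> skS; rewrite -det_sub_rank1; last exact/monic_neq0/char_poly_monic.
rewrite -[LHS]/(comp_poly _ _) -det_map_mx -det_tr; congr (\det _).
apply/matrixP => i j; have /matrixP/(_ i j) := skS; rewrite !mxE => Sji.
rewrite big_ord1 !mxE mulr1 eq_sym Sji rmorphB /= rmorphMn /= comp_polyX.
rewrite comp_polyC !rmorphB !rmorphMn /=.
by case: (i == j) => /=; rewrite ?mulr1n ?mulr0n; ring.
Qed.

Lemma gen_cospectral_walk_count n (S D : 'M[int]_n) k : skewsym S -> skewsym D ->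
  gen_cospectral S D -> walk_count S k = walk_count D k.
Proof.
move=> skS skD [e1 e2]; apply: (walk_count_uniq _ e1).
have := skew_complement_char_poly skS; rewrite e2 (skew_complement_char_poly skD) e1.
set x := (X in _ - X = _); set y := (X in _ = _ - X).
by move=> /addrI /oppr_inj /esym; apply.
Qed.

(** * The orthogonal matrix carrying one walk matrix to another *)

Lemma rat_mxM m n k (A : 'M[int]_(m, n)) (B : 'M[int]_(n, k)) :
  rat_mx (A *m B) = rat_mx A *m rat_mx B.
Proof. exact: map_mxM. Qed.

Lemma rat_mx_tr m n (A : 'M[int]_(m, n)) : rat_mx A^T = (rat_mx A)^T.
Proof. by rewrite /rat_mx map_trmx. Qed.

Lemma rat_mxN m n (A : 'M[int]_(m, n)) : rat_mx (- A) = - rat_mx A.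
Proof. exact: map_mxN. Qed.

Lemma det_rat_mx n (A : 'M[int]_n) : \det (rat_mx A) = (\det A)%:~R.
Proof. exact: det_map_mx. Qed.

Lemma rat_mx_inj m n : injective (@rat_mx m n).
Proof.
move=> A B /matrixP eqAB; apply/matrixP => i j.
by have := eqAB i j; rewrite !mxE => /intr_inj.
Qed.

Lemma col_walk_mx n (S : 'M[int]_n) j : col j (walk_mx S) = walk_vec S j.
Proof. by apply/colP => i; rewrite !mxE. Qed.

Lemma col_mulmx (R : pzRingType) m n k (A : 'M[R]_(m, n)) (B : 'M[R]_(n, k)) j :
  col j (A *m B) = A *m col j B.
Proof. by rewrite !colE mulmxA. Qed.

Lemma tr_mulmx_col (R : comPzRingType) m n k (A : 'M[R]_(m, n)) (B : 'M[R]_(m, k)) i j :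
  (A^T *m B) i j = ((col i A)^T *m col j B) 0 0.
Proof. by rewrite !mxE; apply: eq_bigr => l _; rewrite !mxE. Qed.

(** Each factor S moved across the inner product costs a sign. Gram matrices of walk vectors thus
    depend on the walk counts alone. *)
Lemma skew_walk_vec n (S : 'M[int]_n) i j : skewsym S ->
  ((walk_vec S i)^T *m walk_vec S j) 0 0 = (-1) ^+ i * walk_count S (i + j).
Proof.
move=> skS; elim: i j => [|i IH] j.
  by rewrite mul1r /walk_count add0n trmx_const.
rewrite walk_vecS trmx_mul skS mulmxN mulNmx -mulmxA -walk_vecS mxE IH.
by rewrite addnS exprS; ring.
Qed.

Section Transfer.
Variables (n : nat) (S D : 'M[int]_n).
Hypotheses (skS : skewsym S) (skD : skewsym D).
Hypothesis eqh : forall k, walk_count S k = walk_count D k.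

Lemma walk_gram_eq : (walk_mx S)^T *m walk_mx S = (walk_mx D)^T *m walk_mx D.
Proof.
apply/matrixP => i j; rewrite [LHS]tr_mulmx_col [RHS]tr_mulmx_col !col_walk_mx.
by rewrite (skew_walk_vec _ _ skS) (skew_walk_vec _ _ skD) eqh.
Qed.

Lemma walk_skew_gram_eq :
  (walk_mx S)^T *m (S *m walk_mx S) = (walk_mx D)^T *m (D *m walk_mx D).
Proof.
apply/matrixP => i j; rewrite [LHS]tr_mulmx_col [RHS]tr_mulmx_col !col_mulmx !col_walk_mx.
by rewrite -!walk_vecS (skew_walk_vec _ _ skS) (skew_walk_vec _ _ skD) eqh.
Qed.

Definition transfer : 'M[rat]_n := rat_mx (walk_mx D) *m invmx (rat_mx (walk_mx S)).

Hypothesis detS : \det (walk_mx S) != 0.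

Lemma rat_walk_unit : rat_mx (walk_mx S) \in unitmx.
Proof. by rewrite unitmxE det_rat_mx unitfE intr_eq0. Qed.

Lemma transferK : transfer *m rat_mx (walk_mx S) = rat_mx (walk_mx D).
Proof. by rewrite mulmxKV ?rat_walk_unit. Qed.

Lemma transfer_orth : transfer^T *m transfer = 1%:M.
Proof.
have h : (rat_mx (walk_mx D))^T *m rat_mx (walk_mx D) =
    (rat_mx (walk_mx S))^T *m rat_mx (walk_mx S).
  by rewrite -!rat_mx_tr -!rat_mxM walk_gram_eq.
rewrite /transfer trmx_mul -mulmxA (mulmxA _ (rat_mx (walk_mx D))) h.
by rewrite -mulmxA mulmxV ?rat_walk_unit // mulmx1 -trmx_mul mulmxV ?rat_walk_unit // trmx1.
Qed.

Lemma transfer_orthr : transfer *m transfer^T = 1%:M.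
Proof. exact/mulmx1C/transfer_orth. Qed.

Lemma transfer_ones : transfer *m rat_mx (onevec n) = rat_mx (onevec n).
Proof.
case: (posnP n) => n0.
  by apply/colP => i; have := ltn_ord i; rewrite [X in (_ < X)%N]n0.
have h A : col (Ordinal n0) (rat_mx (walk_mx A)) = rat_mx (onevec n).
  by apply/colP => i; rewrite !mxE.
by rewrite -{1}(h S) -col_mulmx transferK h.
Qed.

(** Multiplied by W(S) on the right and W(D)^T on the left, the two sides become W(S)^T S W(S) and
    W(D)^T D W(D), equal by [walk_skew_gram_eq]; both multipliers are invertible. *)
Lemma transfer_similar : transfer *m rat_mx S = rat_mx D *m transfer.
Proof.
move: transfer_orth transferK; move: transfer => P PTP PW.
have WDu : (rat_mx (walk_mx D))^T \in unitmx.
  rewrite unitmx_tr -PW unitmx_mul rat_walk_unit andbT.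
  by case: (mulmx1_unit PTP).
apply: (can_inj (mulmxK rat_walk_unit)); rewrite -[in RHS]mulmxA PW.
apply: (can_inj (mulKmx WDu)); rewrite -[in LHS]PW trmx_mul -!mulmxA.
rewrite (mulmxA P^T P) PTP mul1mx -!rat_mxM -!rat_mx_tr -!rat_mxM.
by rewrite walk_skew_gram_eq.
Qed.
End Transfer.

(** * Polynomials in S applied to e, and the companion matrix *)

Lemma mulmx_expr_walk (R : comNzRingType) n (A : 'M[R]_n.+1) k :
  A ^+ k *m const_mx 1 = walk_vec A k.
Proof.
elim: k => [|k IH]; first by rewrite expr0 mul1mx.
by rewrite exprS -[A * _]/(A *m _) -mulmxA IH.
Qed.

Lemma horner_mx_walk (R : comNzRingType) n (A : 'M[R]_n.+1) (q : {poly R}) m : (size q <= m)%N ->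
  horner_mx A q *m const_mx 1 = \sum_(i < m) q`_i *: walk_vec A i.
Proof.
move=> qm; have -> : q = \poly_(i < m) q`_i.
  apply/polyP => i; rewrite coef_poly; case: ltnP => // mi.
  by rewrite nth_default // (leq_trans qm).
rewrite poly_def linear_sum mulmx_suml; apply: eq_bigr => i _ /=.
rewrite linearZ /= rmorphXn /= horner_mx_X -scalemxAl mulmx_expr_walk.
by rewrite -poly_def coef_poly ltn_ord.
Qed.

(** Multiplication by X on R[X] / ([char_poly A]), in the basis of the powers of X. *)
Definition companion_col (R : nzRingType) n (A : 'M[R]_n) : 'M[R]_n :=
  \matrix_(i, j) if j.+1 == n then - (char_poly A)`_i else (i == j.+1 :> nat)%:R.

(** S shifts the columns of the walk matrix; Cayley-Hamilton expresses the image of the last one. *)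
Lemma walk_companion n (S : 'M[int]_n) :
  S *m walk_mx S = walk_mx S *m companion_col S.
Proof.
suff h j : col j (S *m walk_mx S) = col j (walk_mx S *m companion_col S).
  by apply/matrixP => i j; have /colP/(_ i) := h j; rewrite mxE [RHS]mxE.
rewrite !col_mulmx col_walk_mx -walk_vecS.
have -> : walk_mx S *m col j (companion_col S) =
  \sum_i companion_col S i j *: walk_vec S i.
  apply/colP => k; rewrite mxE summxE; apply: eq_bigr => i _.
  by rewrite !mxE mulrC.
have [jn|jn] := eqVneq j.+1 n; last first.
  have jn' : (j.+1 < n)%N by rewrite ltn_neqAle jn ltn_ord.
  rewrite (bigD1 (Ordinal jn')) //= big1 => [|i ij].
    by rewrite addr0 mxE (negPf jn) eqxx scale1r.
  rewrite mxE (negPf jn); suff /negPf -> : i != j.+1 :> nat by rewrite scale0r.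
  by apply: contraNneq ij => h; apply/eqP/val_inj.
under eq_bigr => i _ do rewrite mxE jn eqxx scaleNr.
case: n => [|n] in S j jn *; first by case: j jn.
have := Cayley_Hamilton S => /(congr1 (mulmx^~ (const_mx 1 : 'cV_n.+1))).
rewrite mul0mx (@horner_mx_walk _ _ _ _ n.+2) ?size_char_poly // big_ord_recr /=.
rewrite sumrN.
have := char_poly_monic S; rewrite monicE lead_coefE size_char_poly /= => /eqP ->.
by case: jn => ->; rewrite scale1r => /eqP; rewrite addrC addr_eq0 => /eqP.
Qed.

(** * Integrality at the prime 2 *)

Lemma mxOver_inv (F : fieldType) (S : subringClosed F) n (A : 'M[F]_n) :
  A \in unitmx -> A \is a mxOver S -> (\det A)^-1 \in S -> invmx A \is a mxOver S.
Proof.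
move=> uA hA hd; rewrite /invmx uA mxOverZ //; apply/mxOverP => i j.
rewrite mxE rpredMsign mxOver_det //; apply/mxOverP => k l.
by rewrite !mxE; apply: (mxOverP hA).
Qed.

Lemma coef_comp_polyNX (R : comNzRingType) (q : {poly R}) i :
  (q \Po - 'X)`_i = (-1) ^+ i * q`_i.
Proof.
elim/poly_ind: q i => [|q c IH] i; first by rewrite comp_poly0 !coef0 mulr0.
rewrite comp_polyD comp_polyM comp_polyX comp_polyC !coefD !coefC mulrN coefN !coefMX.
by case: i => [|i] /=; rewrite ?IH ?exprS; ring.
Qed.

(** Transposing X - S gives chi(X) = (-1)^n chi(-X), so a coefficient of the wrong parity equals its
    opposite. *)
Lemma skew_char_poly_parity n (S : 'M[int]_n) i : skewsym S -> odd (n + i) ->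
  (char_poly S)`_i = 0.
Proof.
move=> skS oni.
have e : char_poly S = (-1) ^+ n * (char_poly S \Po - 'X).
  rewrite -[char_poly S \Po _]/(comp_poly _ _) -det_map_mx -detZ -[LHS]det_tr.
  congr (\det _); apply/matrixP => k l; have /matrixP/(_ k l) := skS.
  rewrite !mxE => ->; rewrite rmorphB /= rmorphMn /= comp_polyX comp_polyC eq_sym.
  by rewrite rmorphN; case: (k == l); rewrite ?mulr1n ?mulr0n; ring.
have := congr1 (fun q : {poly int} => q`_i) e; rewrite /=.
have -> : (-1) ^+ n = ((-1) ^+ n)%:P :> {poly int} by rewrite rmorphXn rmorphN1.
rewrite coefCM coef_comp_polyNX mulrA -exprD -signr_odd oni expr1 mulN1r.
by move=> /eqP; rewrite -addr_eq0 -mulr2n mulrn_eq0 => /eqP.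
Qed.

Lemma F2_sqr (c : 'F_2) : c ^+ 2 = c.
Proof. by case: c => [[|[|//]] ?]; apply/val_inj. Qed.

Lemma F2_oppr (c : 'F_2) : - c = c.
Proof. by case: c => [[|[|//]] ?]; apply/val_inj. Qed.

Lemma F2_poly_sqr (q : {poly 'F_2}) : q ^+ 2 = q \Po 'X^2.
Proof.
have two0 : 1 + 1 = 0 :> {poly 'F_2}.
  by rewrite -[1 + 1]/((1 : {poly 'F_2}) *+ 2) -polyCMn /= (_ : 1 *+ 2 = 0) //; apply/val_inj.
elim/poly_ind: q => [|q c IH]; first by rewrite comp_poly0 expr0n.
rewrite comp_polyD comp_polyM comp_polyX comp_polyC -IH -[in RHS](F2_sqr c) rmorphXn.
rewrite (_ : _ ^+ 2 = q ^+ 2 * 'X^2 + c%:P ^+ 2 + (1 + 1) * (q * 'X * c%:P)); last by ring.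
by rewrite two0 mul0r addr0.
Qed.

(* In characteristic 2 the characteristic polynomial of a skew-symmetric matrix
   is, up to a factor 'X when n is odd, the square of this polynomial. *)
Definition half_poly n (S : 'M[int]_n) : {poly int} :=
  if odd n then 'X * odd_poly (char_poly S) else even_poly (char_poly S).

(** By parity chi is g(X^2) for even n and X g(X^2) for odd n, and g(X^2) = g^2 over F_2. For odd n
    the factor 'X put into [half_poly] makes its square X chi, still a multiple of chi. *)
Lemma half_poly_sqr n (S : 'M[int]_n) : skewsym S ->
  map_poly intr (half_poly S) ^+ 2 = 'X^(odd n) * map_poly intr (char_poly S) :> {poly 'F_2}.
Proof.
move=> skS; rewrite /half_poly; set chi := char_poly S.
have parts (b : bool) : (forall i, odd i = b -> chi`_i = 0) ->
    chi = if b then even_poly chi \Po 'X^2 else (odd_poly chi \Po 'X^2) * 'X.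
  move=> h; rewrite -[LHS]poly_even_odd; case: b h => h.
    rewrite (_ : odd_poly chi = 0) ?comp_poly0 ?mul0r ?addr0 //.
    by apply/polyP => i; rewrite coef_odd_poly coef0 h //= odd_double.
  rewrite (_ : even_poly chi = 0) ?comp_poly0 ?add0r //.
  by apply/polyP => i; rewrite coef_even_poly coef0 h //= odd_double.
case on: (odd n).
  have e := parts false _; rewrite {2}e => [|i oi]; last first.
    by apply: skew_char_poly_parity; rewrite // oddD on oi.
  rewrite rmorphM /= map_polyX exprMn (F2_poly_sqr (map_poly _ _)) rmorphM /= map_polyX.
  by rewrite map_comp_poly map_polyXn expr1 [RHS]mulrCA -expr2 mulrC.
have e := parts true _; rewrite {2}e => [|i oi]; last first.
  by apply: skew_char_poly_parity; rewrite // oddD on oi.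
by rewrite expr0 mul1r F2_poly_sqr map_comp_poly map_polyXn.
Qed.

Lemma size_half_poly n (S : 'M[int]_n) : (size (half_poly S) <= (uphalf n).+1)%N.
Proof.
apply/leq_sizeP => j nj; have h k : (n < k)%N -> (char_poly S)`_k = 0.
  by move=> nk; rewrite nth_default // size_char_poly.
rewrite /half_poly; case on: (odd n); rewrite ?coefXM ?coef_odd_poly ?coef_even_poly.
  by case: j nj => //= j nj; rewrite h //; lia.
by rewrite h //; lia.
Qed.

Lemma half_poly_lead n (S : 'M[int]_n) : (half_poly S)`_(uphalf n) = 1.
Proof.
have cn : (char_poly S)`_n = 1.
  by have := char_poly_monic S; rewrite monicE lead_coefE size_char_poly /= => /eqP.
rewrite /half_poly; case on: (odd n); rewrite ?coefXM ?coef_odd_poly ?coef_even_poly; last first.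
  by rewrite -[RHS]cn; congr (_`_ _); lia.
have -> : (uphalf n == 0)%N = false by lia.
by rewrite -[RHS]cn; congr (_`_ _); lia.
Qed.

Lemma trmx_horner_mx (R : comNzRingType) n (A : 'M[R]_n.+1) q : A^T = A ->
  (horner_mx A q)^T = horner_mx A q.
Proof.
move=> symA; elim/poly_ind: q => [|q c IH]; first by rewrite rmorph0 trmx0.
rewrite rmorphD /= linearD /= horner_mx_C tr_scalar_mx; congr (_ + _).
by rewrite {1}mulrC !rmorphM /= horner_mx_X trmx_mul IH symA.
Qed.

(* Over F_2 the i-th coordinate of B e is the (i, i) entry of B B^T. *)
Lemma F2_sym_sqr0 n (B : 'M['F_2]_n) : B^T = B -> B *m B = 0 ->
  B *m const_mx 1 = 0 :> 'cV_n.
Proof.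
move=> symB sqB; apply/colP => i; rewrite mxE [RHS]mxE.
have /matrixP/(_ i i) := sqB; rewrite mxE [X in _ = X -> _]mxE.
apply: etrans; apply: eq_bigr => j _; rewrite mxE mulr1 -[LHS]F2_sqr expr2; congr (_ * _).
by rewrite -{1}symB mxE.
Qed.

Lemma int_F2_eq0 (k : int) : (k%:~R == 0 :> 'F_2) = (2 %| k)%Z.
Proof. by rewrite (dvdz_pcharf (pchar_Fp (isT : prime 2))). Qed.

(** Modulo 2, S is symmetric and B = f(S), with f the half polynomial, squares to 0 by
    Cayley-Hamilton; so B e = 0 by [F2_sym_sqr0], and multiplying by S^k preserves this. *)
Lemma half_poly_walk_even n (S : 'M[int]_n.+1) k i : skewsym S ->
  (2 %| (horner_mx S ('X^k * half_poly S) *m (const_mx 1 : 'cV_n.+1)) i ord0)%Z.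
Proof.
move=> skS; rewrite -int_F2_eq0; pose S2 := map_mx (intr : int -> 'F_2) S.
pose B := horner_mx S2 (map_poly intr (half_poly S)).
have symS2 : S2^T = S2.
  apply/matrixP => a b; have /matrixP/(_ a b) := skS; rewrite !mxE => ->.
  by rewrite rmorphN F2_oppr.
have Be : B *m const_mx 1 = 0 :> 'cV_n.+1.
  apply: F2_sym_sqr0; first exact: trmx_horner_mx.
  rewrite -[B *m B]/(B ^+ 2) -rmorphXn /= half_poly_sqr // rmorphM /=.
  by rewrite map_char_poly Cayley_Hamilton mulr0.
have : map_mx (intr : int -> 'F_2)
    (horner_mx S ('X^k * half_poly S) *m (const_mx 1 : 'cV_n.+1)) = 0.
  rewrite map_mxM map_horner_mx map_const_mx !rmorphM /=.
  by rewrite -[_ * _]/(_ *m _) -mulmxA -[X in _ *m X]/(B *m const_mx 1) Be mulmx0.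
by move=> /matrixP/(_ i ord0); rewrite !mxE => ->.
Qed.

(** A change of basis on the right of the walk matrix: it keeps the first [uphalf n] columns and
    replaces the others by S^k f(S) e / 2, where f is [half_poly S]. It depends on S only through
    [char_poly S]. *)
Definition half_basis n (S : 'M[int]_n) : 'M[rat]_n :=
  \matrix_(i, j) if (j < uphalf n)%N then (i == j)%:R
                 else (('X^(j - uphalf n) * half_poly S)`_i)%:~R / 2%:R.

(** Triangular since f is monic of degree [uphalf n]; the diagonal has [n./2] entries 1/2. This
    cancels the power of 2 in \det W exactly. *)
Lemma det_half_basis n (S : 'M[int]_n) : \det (half_basis S) = (2 ^ n./2)%:R^-1.
Proof.
rewrite -det_tr det_trig; last first.
  apply/is_trig_mxP => i j ij; rewrite !mxE; case: ltnP => hi.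
    by rewrite eq_sym -val_eqE /= ltn_eqF.
  rewrite coefXnM; case: ltnP => [_|hj]; first by rewrite mul0r.
  rewrite nth_default ?mul0r //; apply: leq_trans (size_half_poly S) _.
  by rewrite ltn_subRL; lia.
have hd i : (half_basis S)^T i i = if (i < uphalf n)%N then 1 else 2%:R^-1.
  rewrite !mxE eqxx; case: ltnP => // hi; rewrite coefXnM ltnNge leq_subr /=.
  by rewrite subKn // half_poly_lead mul1r.
under eq_bigr => i _ do rewrite hd.
rewrite -(big_mkord xpredT (fun i => if (i < uphalf n)%N then 1 else 2%:R^-1)) /=.
rewrite (@big_cat_nat _ _ _ (uphalf n)) //=; last by lia.
rewrite big_nat big1 ?mul1r => [|i /andP[_ ->] //].
rewrite big_nat (eq_bigr (fun=> 2%:R^-1)) => [|i /andP[h _]]; last by rewrite ltnNge h.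
rewrite -big_nat prodr_const_nat exprVn natrX; congr (_ ^+ _)^-1; lia.
Qed.

Lemma half_basis_zloc2 n (S : 'M[int]_n) : skewsym S ->
  rat_mx (walk_mx S) *m half_basis S \is a mxOver (zloc 2).
Proof.
move=> skS; apply/mxOverP => i j; rewrite mxE.
have [jm|mj] := ltnP j (uphalf n).
  apply: rpred_sum => k _; rewrite rpredM //; first by rewrite mxE zloc_int.
  by rewrite mxE jm; exact: rpred_nat.
case: n => [|n] in S skS i j mj *; first by case: i.
pose k := (j - uphalf n.+1)%N.
have := half_poly_walk_even k i skS.
rewrite (@horner_mx_walk _ _ _ _ n.+1); last first.
  apply/leq_sizeP => l nl; rewrite coefXnM; case: ltnP => // kl.
  rewrite nth_default //; apply: leq_trans (size_half_poly S) _.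
  have := ltn_ord j; rewrite /k in kl *; lia.
move=> /dvdzP[c hc]; suff -> : \sum_j0 rat_mx (walk_mx S) i j0 * half_basis S j0 j = c%:~R.
  exact: zloc_int.
apply: (can_inj (mulfK (_ : 2%:R != 0 :> rat))) => //.
rewrite -[c%:~R * _](rmorphM intr c 2) /= -hc summxE rmorph_sum mulr_suml.
apply: eq_bigr => l _; rewrite !mxE ltnNge mj /= -/k rmorphM /= -mulrA divfK // mulrC.
by [].
Qed.

(** The same change of basis serves S and D, so the transfer matrix is also V(D) V(S)^-1. Both V are
    2-integral and \det V(S) = q is odd. *)
Lemma transfer_zloc2 n (S D : 'M[int]_n) (q : int) : skewsym S -> skewsym D ->
  char_poly S = char_poly D -> \det (walk_mx S) = q * (2 ^ n./2)%:R -> odd `|q| ->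
  transfer S D \is a mxOver (zloc 2).
Proof.
move=> skS skD eqchi detS oq.
have q0 : q != 0 by apply: contraTneq oq => ->.
have dS : \det (walk_mx S) != 0 by rewrite detS mulf_neq0 // pnatr_eq0 expn_eq0.
pose V A := rat_mx (walk_mx A) *m half_basis S.
have hS : V S \is a mxOver (zloc 2) by exact: half_basis_zloc2.
have hD : V D \is a mxOver (zloc 2).
  by rewrite /V (_ : half_basis S = half_basis D) ?half_basis_zloc2 // /half_basis /half_poly eqchi.
have detV : \det (V S) = q%:~R.
  rewrite det_mulmx det_half_basis det_rat_mx detS rmorphM /= rmorph_nat mulfK //.
  by rewrite pnatr_eq0 expn_eq0.
have uV : V S \in unitmx by rewrite unitmxE detV unitfE intr_eq0.
have -> : transfer S D = V D *m invmx (V S).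
  by rewrite /V -(transferK D dS) -(mulmxA (transfer S D)) mulmxK.
rewrite mxOverM // mxOver_inv // detV zlocV_int // prime_coprime // dvdn2 oq //.
Qed.

(** * Odd primes: orthogonal matrices whose non-integral part has rank one *)

Lemma rank1_mul_tr n (p : nat) (y2 y3 : 'cV[rat]_n) (z : 'rV[rat]_n) (F2 F3 : 'M[rat]_n) i j :
  ((p%:R^-1 *: (y2 *m z) + F2) *m (p%:R^-1 *: (y3 *m z) + F3)^T) i j =
  (z *m z^T) 0 0 / p%:R * y2 i 0 * y3 j 0 / p%:R +
  (y2 i 0 * (F3 *m z^T) j 0 + (F2 *m z^T) i 0 * y3 j 0) / p%:R + (F2 *m F3^T) i j.
Proof.
rewrite linearD linearZ /= trmx_mul mulmxDr !mulmxDl -?scalemxAl -?scalemxAr -?scalemxAl -?scalemxAr.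
have e1 : y2 *m z *m (z^T *m y3^T) = (z *m z^T) 0 0 *: (y2 *m y3^T).
  by rewrite -mulmxA (mulmxA z) {1}[z *m z^T]mx11_scalar mul_scalar_mx scalemxAr.
have e2 : y2 *m z *m F3^T = y2 *m (F3 *m z^T)^T by rewrite trmx_mul trmxK mulmxA.
have e3 : F2 *m (z^T *m y3^T) = (F2 *m z^T) *m y3^T by rewrite mulmxA.
have e4 (u v : 'cV[rat]_n) : (u *m v^T) i j = u i 0 * v j 0.
  by rewrite mxE big_ord1 mxE.
rewrite e1 e2 e3; set cc := (z *m z^T) 0 0; set t3 := F3 *m z^T; set t2 := F2 *m z^T.
set f := F2 *m F3^T; move: cc t3 t2 f => cc t3 t2 f.
have e5 (A B : 'M[rat]_n) : (A + B) i j = A i j + B i j by rewrite mxE.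
have e6 a (B : 'M[rat]_n) : (a *: B) i j = a * B i j by rewrite mxE.
by rewrite !(e5, e6) !e4; ring.
Qed.

Section OddPrime.
Variables (p n : nat).
Hypotheses (pp : prime p) (po : odd p).
Notation Zp := (zloc p).
Local Notation pi := (p%:R : rat).

Let pi0 : pi != 0. Proof. by rewrite pnatr_eq0 -lt0n prime_gt0. Qed.
Let piZ : pi \in Zp. Proof. exact: rpred_nat. Qed.

Lemma zloc_rank1_notin (y : 'cV[rat]_n) (z : 'rV[rat]_n) (F : 'M[rat]_n) :
  z \is a mxOver Zp -> F \is a mxOver Zp ->
  pi^-1 *: (y *m z) + F \isn't a mxOver Zp -> exists i, y i 0 / pi \notin Zp.
Proof.
move=> hz hF hP; case: (boolP [exists i, y i 0 / pi \notin Zp]) => [/existsP //|].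
rewrite negb_exists => /forallP hy; case/negP: hP; rewrite rpredD // scalemxAl mxOverM //.
by apply/mxOverP => i j; rewrite ord1 mxE mulrC; have := hy i; rewrite negbK.
Qed.

Lemma mxOver_col (m : nat) (v : 'cV[rat]_m) i : v \is a mxOver Zp -> v i 0 \in Zp.
Proof. by move=> /mxOverP. Qed.

(* Orthogonality of P forces z to be isotropic mod p and F z^T to be
   -(z z^T / 2p) y mod p; so F z^T is determined mod p by y. *)
Lemma orth_rank1_relation (y : 'cV[rat]_n) (z : 'rV[rat]_n) (F P : 'M[rat]_n) :
  y \is a mxOver Zp -> z \is a mxOver Zp -> F \is a mxOver Zp ->
  P = pi^-1 *: (y *m z) + F -> P *m P^T = 1%:M -> P \isn't a mxOver Zp ->
  (z *m z^T) 0 0 / pi \in Zp /\ forall j,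
  ((z *m z^T) 0 0 / pi * y j 0 + 2%:R * (F *m z^T) j 0) / pi \in Zp.
Proof.
move=> hy hz hF eP orthP nP; rewrite eP in orthP nP.
have [i0 hi0] := zloc_rank1_notin hz hF nP.
have orth i j : (z *m z^T) 0 0 / pi * y i 0 * y j 0 / pi +
    (y i 0 * (F *m z^T) j 0 + (F *m z^T) i 0 * y j 0) / pi + (F *m F^T) i j = (i == j)%:R.
  by rewrite -rank1_mul_tr orthP mxE.
have yi i : y i 0 \in Zp by exact: mxOver_col.
have ti i : (F *m z^T) i 0 \in Zp by rewrite mxOver_col // mxOverM // mxOver_tr.
have fi i j : (F *m F^T) i j \in Zp.
  by apply: (mxOverP _); rewrite mxOverM // mxOver_tr.
have cZ : (z *m z^T) 0 0 \in Zp by rewrite mxOver_col // mxOverM // mxOver_tr.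
move: (F *m z^T) (F *m F^T) ((z *m z^T) 0 0) orth ti fi cZ => t f c orth ti fi cZ.
have sZ : c / pi \in Zp.
  (* Multiplied by p, the diagonal entry at [i0] of P P^T = 1 bounds the denominator of y^2 c / p; y
     is a unit there and cancels twice. *)
  apply: (zloc_cancel pp (yi i0) hi0); apply: (zloc_cancel pp (yi i0) hi0).
  have -> : y i0 0 * (y i0 0 * c) / pi =
      pi * (1 - f i0 i0) - 2%:R * (y i0 0 * t i0 0).
    have := orth i0 i0; rewrite eqxx mulr1n => e; rewrite -[X in pi * (X - _)]e.
    by field; exact: pi0.
  by rewrite rpredB ?rpredM ?rpredB ?rpred1 // rpred_nat.
split=> //; set s := c / pi in orth sZ *.
(* The same entry, without the factor p, is the wanted relation at [i0]; row [i0] then propagates it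
   to every [j]. *)
have g0 : (s * y i0 0 + 2%:R * t i0 0) / pi \in Zp.
  apply: (zloc_cancel pp (yi i0) hi0).
  have -> : y i0 0 * (s * y i0 0 + 2%:R * t i0 0) / pi = 1 - f i0 i0.
    have := orth i0 i0; rewrite eqxx mulr1n => e; rewrite -[X in _ = X - _]e.
    by rewrite /s; field; exact: pi0.
  by rewrite rpredB ?rpred1.
move=> j; apply: (zloc_cancel pp (yi i0) hi0).
have -> : y i0 0 * (s * y j 0 + 2%:R * t j 0) / pi =
   2%:R * ((i0 == j)%:R - f i0 j) - (s * y i0 0 + 2%:R * t i0 0) / pi * y j 0.
  rewrite -orth; field; exact: pi0.
by rewrite rpredB // rpredM // ?rpredB ?rpred_nat.
Qed.

(** Twice the part of an entry with denominator p is y2 (s y3 + 2 F3 z^T) / p + (s y2 + 2 F2 z^T) y3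
    / p, where s = z z^T / p. Both brackets are divisible by p by [orth_rank1_relation], and 2
    cancels because p is odd. *)
Lemma orth_rank1_pair (y2 y3 : 'cV[rat]_n) (z : 'rV[rat]_n) (F2 F3 P2 P3 : 'M[rat]_n) :
  y2 \is a mxOver Zp -> y3 \is a mxOver Zp -> z \is a mxOver Zp ->
  F2 \is a mxOver Zp -> F3 \is a mxOver Zp ->
  P2 = pi^-1 *: (y2 *m z) + F2 -> P3 = pi^-1 *: (y3 *m z) + F3 ->
  P2 *m P2^T = 1%:M -> P3 *m P3^T = 1%:M ->
  P2 \isn't a mxOver Zp -> P3 \isn't a mxOver Zp ->
  P2 *m P3^T \is a mxOver Zp.
Proof.
move=> hy2 hy3 hz hF2 hF3 e2 e3 o2 o3 n2 n3.
have [sZ g2] := orth_rank1_relation hy2 hz hF2 e2 o2 n2.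
have [_ g3] := orth_rank1_relation hy3 hz hF3 e3 o3 n3.
apply/mxOverP => i j; rewrite e2 e3 rank1_mul_tr.
have y2i : y2 i 0 \in Zp by exact: mxOver_col.
have y3j : y3 j 0 \in Zp by exact: mxOver_col.
have t2i : (F2 *m z^T) i 0 \in Zp by rewrite mxOver_col // mxOverM // mxOver_tr.
have t3j : (F3 *m z^T) j 0 \in Zp by rewrite mxOver_col // mxOverM // mxOver_tr.
rewrite rpredD //; last by apply: (mxOverP _); rewrite mxOverM // mxOver_tr.
have := g2 i; have := g3 j; move: ((z *m z^T) 0 0 / pi) sZ => s sZ h3 h2.
rewrite -mulrDl; apply: zloc_halve => //.
set a := y2 i 0 in y2i h2 *; set b := y3 j 0 in y3j h3 *.
rewrite (_ : _ / pi = a * ((s * b + 2%:R * (F3 *m z^T) j 0) / pi) +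
   (s * a + 2%:R * (F2 *m z^T) i 0) / pi * b); last by field; exact: pi0.
by rewrite rpredD // rpredM.
Qed.

End OddPrime.

(** * Primes dividing the walk determinant exactly once *)

(** Replacing the first row of the companion matrix by the last unit row gives [C'] of determinant 1
    or -1, whatever the constant term of chi. In C' H only the first row, which is the last row of
    H, can have a denominator, and p clears it. *)
Lemma companion_scaled_det p n (S : 'M[int]_n) (H : 'M[rat]_n) :
  rat_mx (companion_col S) *m H \is a mxOver (zloc p) ->
  p%:R *: H \is a mxOver (zloc p) -> p%:R * \det H \in zloc p.
Proof.
case: n => [|n] in S H *; first by rewrite det_mx00 mulr1 rpred_nat.
move=> hCH hpH.
pose C' : 'M[rat]_n.+1 := \matrix_(i, j) if i == 0 then (j == ord_max)%:R
                                          else rat_mx (companion_col S) i j.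
have detC' : \det C' = (-1) ^+ n.
  rewrite (expand_det_row _ 0) (bigD1 ord_max) //= big1 => [|j /negPf jm]; last first.
    by rewrite mxE eqxx jm mul0r.
  rewrite addr0 mxE !eqxx mul1r /cofactor /= (_ : row' _ _ = 1%:M) ?det1 ?mulr1 //.
  apply/matrixP => i j; rewrite !mxE /= eqSS.
  rewrite ltn_eqF ?ltnS ?[bump _ _]lift_max ?lift_max //=.
  by rewrite /bump leq0n (leqNgt n) (ltn_ord j) add0n add1n eqSS rmorph_nat.
have <- : (-1) ^+ n * \det (C' *m H) = \det H.
  by rewrite det_mulmx detC' mulrA -exprD addnn -signr_odd odd_double mul1r.
rewrite mulrCA rpredMsign; apply: (mxOver_row_det (i0 := 0)) => [i j i0|j].
  have -> : (C' *m H) i j = (rat_mx (companion_col S) *m H) i j.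
    by rewrite !mxE; apply: eq_bigr => k _; rewrite !mxE (negPf i0).
  exact: (mxOverP hCH).
rewrite mxE (bigD1 ord_max) //= big1 => [|k /negPf km]; last by rewrite mxE eqxx km mul0r.
by rewrite addr0 mxE !eqxx mul1r; have /mxOverP/(_ ord_max j) := hpH; rewrite mxE.
Qed.

(* By the Smith normal form, V^-1 has rank one modulo the integral matrices;
   b and w witness that a and z are primitive. *)
Lemma corank1_inverse p n (V : 'M[int]_n) : prime p ->
  (p %| \det V)%Z -> ~~ ((p ^ 2)%N %| \det V)%Z ->
  exists (a w : 'cV[rat]_n) (z b : 'rV[rat]_n) (E : 'M[rat]_n),
  [/\ [/\ a \is a mxOver (zloc p), w \is a mxOver (zloc p), z \is a mxOver (zloc p),
          b \is a mxOver (zloc p) & E \is a mxOver (zloc p)],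
      invmx (rat_mx V) = p%:R^-1 *: (a *m z) + E, b *m a = 1%:M & z *m w = 1%:M].
Proof.
move=> pp pV p2V.
have pr0 : p%:R != 0 :> rat by rewrite pnatr_eq0 -lt0n prime_gt0.
have V0 : \det V != 0 by apply: contraNneq p2V => ->; exact: dvdz0.
case: n => [|n] in V pV p2V V0 *.
  by move: pV; rewrite det_mx00 dvdzE /= Euclid_dvd1.
have [L uL [R uR [d sd eV]]] := int_Smith_normal_form V.
pose e i : int := d`_i.
pose dg := \row_(i < n.+1) e i.
have eD : \matrix_(i, j) (e i *+ (i == j :> nat)) = diag_mx dg.
  by apply/matrixP => i j; rewrite !mxE.
rewrite {}eD in eV.
have absdet : `|\det V|%N = (\prod_(i < n.+1) `|e i|)%N.
  rewrite eV !det_mulmx det_diag !abszM.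
  have abs1 (A : 'M[int]_n.+1) : A \in unitmx -> `|\det A|%N = 1%N.
    move=> uA; have := congr1 (fun k : int => `|k|%N) (det_mulmx A (invmx A)).
    by rewrite mulmxV // det1 abszM => /esym/eqP; rewrite muln_eq1 => /andP[/eqP].
  rewrite !abs1 // mul1n muln1.
  by rewrite (big_morph absz abszM (erefl _)); apply: eq_bigr => i _; rewrite mxE.
have d0 (i : 'I_n.+1) : e i != 0.
  by apply: contraNneq V0 => di; rewrite -absz_eq0 absdet (bigD1 i) //= di.
have lt_d (i : 'I_n.+1) : (i < size d)%N.
  by rewrite ltnNge; apply: contra (d0 i) => h; rewrite /e nth_default.
have dvd_last (i : 'I_n.+1) : (e i %| e n)%Z.
  apply: (sorted_leq_nth dvdz_trans dvdzz 0 sd); rewrite ?inE ?lt_d //.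
    exact: (lt_d ord_max).
  by rewrite -ltnS.
have absdet' : `|\det V|%N = ((\prod_(i < n) `|e i|) * `|e n|)%N.
  by rewrite absdet big_ord_recr.
(* The invariant factors divide the last one, so p divides the last; being a simple divisor of the
   determinant, p divides no other. *)
have pdn : (p %| `|e n|)%N.
  apply: contraTT pV => npn; rewrite dvdzE absdet Euclid_dvd_prod // big_orE.
  apply/negP => /existsP[i /= pi]; case/negP: npn; apply: dvdn_trans pi _.
  exact: dvd_last.
have p2dn : ~~ (p ^ 2 %| `|e n|)%N.
  by apply: contra p2V => h; rewrite dvdzE absdet' dvdn_mull.
have pdi (i : 'I_n) : coprime p `|e i|.
  rewrite prime_coprime //; apply: contra p2V => h; rewrite dvdzE absdet' -mulnn.
  by rewrite dvdn_mul // (bigD1 i) //= dvdn_mulr.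
pose u i : rat := (e i)%:~R^-1.
have uZ (i : 'I_n.+1) : i != ord_max -> u i \in zloc p.
  move=> im; apply: zlocV_int; have lt_in : (i < n)%N.
    by rewrite ltn_neqAle -ltnS ltn_ord andbT.
  exact: (pdi (Ordinal lt_in)).
(* The unit of [zloc p] by which the last inverse invariant factor differs from 1/p. *)
pose c : rat := p%:R * u n.
have [k ek] : exists k : int, e n = k * p by apply/dvdzP.
have cV : c^-1 = k%:~R by rewrite /c /u invfM invrK ek rmorphM /= mulrC mulfK.
have cVZ : c^-1 \in zloc p by rewrite cV zloc_int.
have cZ : c \in zloc p.
  rewrite -[c]invrK cV zlocV_int // prime_coprime //.
  by apply: contra p2dn => pk; rewrite ek abszM -mulnn dvdn_mul.
have c0 : c != 0 by rewrite mulf_neq0 // invr_eq0 intr_eq0 (d0 ord_max).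
pose Li := rat_mx (invmx L); pose Ri := rat_mx (invmx R).
have LLi : rat_mx L *m Li = 1%:M by rewrite -rat_mxM mulmxV // /rat_mx map_mx1.
have LiL : Li *m rat_mx L = 1%:M by rewrite -rat_mxM mulVmx // /rat_mx map_mx1.
have RRi : rat_mx R *m Ri = 1%:M by rewrite -rat_mxM mulmxV // /rat_mx map_mx1.
pose um := \row_(i < n.+1) (if i == ord_max then 0 else u i).
have um_int : um \is a mxOver (zloc p).
  by apply/mxOverP => i j; rewrite mxE; case: ifP => [_|/negbT/uZ]; rewrite ?rpred0.
(* With V = L D R, the inverse is R^-1 D^-1 L^-1: [a] and [z] come from the last column of R^-1 and
   the last row of L^-1, [w] and [b] from the last column of L and the last row of R. [E] collects
   the other diagonal entries. *)
exists (c *: (Ri *m delta_mx ord_max 0)), (rat_mx L *m delta_mx ord_max 0),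
  (delta_mx 0 ord_max *m Li), (c^-1 *: (delta_mx 0 ord_max *m rat_mx R)),
  (Ri *m diag_mx um *m Li).
have deltaZ x1 x2 (i : 'I_x1) (j : 'I_x2) : delta_mx i j \is a mxOver (zloc p).
  by apply/mxOverP => x y; rewrite mxE rpred_nat.
have delta1 : (delta_mx 0 ord_max : 'rV[rat]_n.+1) *m (delta_mx ord_max 0 : 'cV_n.+1) = 1%:M.
  by rewrite mul_delta_mx; apply/matrixP => i j; rewrite !ord1 !mxE.
split.
- by split; rewrite ?mxOverZ ?mxOverM ?mxOver_rat ?mxOver_diag ?rpred0.
- have key : diag_mx um + u n *: ((delta_mx ord_max 0 : 'cV_n.+1) *m (delta_mx 0 ord_max : 'rV_n.+1)) =
      diag_mx (\row_(i < n.+1) u i).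
    rewrite mul_delta_mx; apply/matrixP => i j; rewrite !mxE.
    have [<-|ij] := eqVneq i j.
      by have [->|im] := eqVneq i ord_max; rewrite /= ?mulr0 ?mulr1 ?add0r ?addr0.
    rewrite !mulr0n add0r; case: andP => [[/eqP im /eqP jm]|_]; last by rewrite mulr0.
    by rewrite im jm eqxx in ij.
  have dd : diag_mx (map_mx intr dg) *m diag_mx (\row_(i < n.+1) u i) = 1%:M.
    rewrite mulmx_diag; apply/matrixP => i j; rewrite !mxE mulfV //.
    by rewrite intr_eq0 d0.
  pose X := Ri *m diag_mx (\row_(i < n.+1) u i) *m Li.
  have VX : rat_mx V *m X = 1%:M.
    rewrite eV !rat_mxM /X {2}/rat_mx map_diag_mx.
    rewrite !mulmxA -[_ *m rat_mx R *m Ri]mulmxA RRi mulmx1.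
    by rewrite -[_ *m diag_mx _ *m diag_mx _]mulmxA dd mulmx1.
  have uV : rat_mx V \in unitmx by case: (mulmx1_unit VX).
  rewrite -[LHS]mulmx1 -VX mulKmx // /X -key mulmxDr mulmxDl addrC; congr (_ + _).
  rewrite -scalemxAl scalerA /c mulrA mulVf // mul1r.
  by rewrite -scalemxAr -scalemxAl !mulmxA.
- rewrite -scalemxAl -scalemxAr scalerA mulVf // scale1r.
  by rewrite -mulmxA (mulmxA (rat_mx R)) RRi mul1mx.
- by rewrite -mulmxA (mulmxA Li) LiL mul1mx.
Qed.

Lemma skew_form_0 n (S : 'M[int]_n) (z : 'rV[rat]_n) : skewsym S ->
  z *m rat_mx S *m z^T = 0.
Proof.
move=> skS; have : (z *m rat_mx S *m z^T)^T = - (z *m rat_mx S *m z^T).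
  by rewrite !trmx_mul trmxK -rat_mx_tr skS rat_mxN mulNmx mulmxN mulmxA.
move=> /matrixP/(_ 0 0); rewrite !mxE => h; apply/matrixP => i j.
by rewrite !ord1 !mxE; apply/eqP; have := h; lra.
Qed.

(** * The left kernel of the walk matrix modulo p, and the reversal *)

Section CorankOne.
Variables (p n : nat) (S : 'M[int]_n).
Hypotheses (pp : prime p) (po : odd p) (skS : skewsym S).
Hypotheses (detS0 : \det (walk_mx S) != 0).
Hypotheses (pdet : (p %| \det (walk_mx S))%Z).
Hypotheses (p2det : ~~ ((p ^ 2)%N %| \det (walk_mx S))%Z).
Variables (a w : 'cV[rat]_n) (z b : 'rV[rat]_n) (E : 'M[rat]_n).
Hypotheses (aZ : a \is a mxOver (zloc p)) (wZ : w \is a mxOver (zloc p))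
  (zZ : z \is a mxOver (zloc p)) (bZ : b \is a mxOver (zloc p))
  (EZ : E \is a mxOver (zloc p)).
Notation W := (rat_mx (walk_mx S)).
Notation pi := (p%:R : rat).
Hypotheses (eWi : invmx W = pi^-1 *: (a *m z) + E) (ba : b *m a = 1%:M)
  (zw : z *m w = 1%:M).

Let pi0 : pi != 0. Proof. by rewrite pnatr_eq0 -lt0n prime_gt0. Qed.
Let piZ : pi \in zloc p. Proof. exact: rpred_nat. Qed.
Let uW : W \in unitmx. Proof. exact: rat_walk_unit. Qed.

(** For H = (W^T W)^-1 the two assumptions make p H and C H = W^-1 S W^-T integral at p, C being the
    companion matrix. Then p \det H is integral at p, whereas \det H = (\det W)^-2 contains exactly
    p^-2. *)
Lemma isotropic_kernel_not_null : (z *m z^T) 0 0 / pi \in zloc p ->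
  pi^-1 *: (z *m rat_mx S) \is a mxOver (zloc p) -> False.
Proof.
move=> cZ rZ; pose Wi := invmx W; pose H := Wi *m Wi^T.
have pH : pi *: H \is a mxOver (zloc p).
  have -> : pi *: H = ((z *m z^T) 0 0 / pi) *: (a *m a^T) +
      (a *m (z *m E^T) + E *m z^T *m a^T) + pi *: (E *m E^T).
    apply/matrixP => i j; rewrite mxE /H /Wi eWi rank1_mul_tr.
    move: (E *m E^T) => f; have -> : z *m E^T = (E *m z^T)^T by rewrite trmx_mul trmxK.
    move: (E *m z^T) ((z *m z^T) 0 0) => t c.
    by rewrite !mxE !big_ord1 !mxE; field.
  by rewrite !rpredD ?mxOverZ ?mxOverM ?mxOver_tr.
have CH : rat_mx (companion_col S) *m H \is a mxOver (zloc p).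
  have -> : rat_mx (companion_col S) *m H = Wi *m rat_mx S *m Wi^T.
    have e : W *m rat_mx (companion_col S) = rat_mx S *m W.
      by rewrite -!rat_mxM walk_companion.
    by rewrite -[rat_mx (companion_col S)](mulKmx uW) e /H !mulmxA mulmxK.
  set r := pi^-1 *: _ in rZ.
  have zS : z *m rat_mx S = pi *: r by rewrite scalerA mulfV // scale1r.
  have Szt : rat_mx S *m z^T = - (pi *: r^T).
    rewrite -linearZ /= -zS trmx_mul -rat_mx_tr skS rat_mxN mulNmx.
    by rewrite opprK.
  (* Skew symmetry removes the only term of W^-1 S W^-T that would retain a denominator p. *)
  have rz : r *m z^T = 0 by rewrite -scalemxAl skew_form_0 // scaler0.
  clearbody r.
  have -> : Wi *m rat_mx S *m Wi^T =
      a *m r *m E^T - E *m r^T *m a^T + E *m rat_mx S *m E^T.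
    rewrite /Wi eWi linearD linearZ /= trmx_mul mulmxDl -scalemxAl -(mulmxA a z) zS.
    rewrite -scalemxAr scalerA mulVf // scale1r mulmxDl !mulmxDr -!scalemxAr.
    rewrite -(mulmxA a r (z^T *m a^T)) (mulmxA r z^T) rz mul0mx mulmx0 scaler0 add0r.
    rewrite -addrA; congr (_ + (_ + _)).
    rewrite -(mulmxA E _ (z^T *m a^T)) (mulmxA _ z^T) Szt mulNmx -scalemxAl.
    by rewrite mulmxN -scalemxAr scalerN scalerA mulVf // scale1r mulmxA.
  by rewrite rpredD ?rpredB ?mxOverM ?mxOver_tr ?mxOver_rat.
have := companion_scaled_det CH pH.
rewrite /H det_mulmx det_tr /Wi det_inv det_rat_mx.
case/dvdzP: pdet p2det => m -> p2 h.
have pm : coprime p `|m|.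
  rewrite prime_coprime //; apply: contra p2 => pm.
  by rewrite dvdzE abszM -mulnn dvdn_mul.
have m0 : m%:~R != 0 :> rat.
  by rewrite intr_eq0; apply: contraNneq p2 => ->; rewrite mul0r dvdz0.
case/negP: (zloc_invp pp).
have -> : pi^-1 = m%:~R * m%:~R * (pi * ((m * p)%:~R^-1 * (m * p)%:~R^-1)).
  by rewrite rmorphM /=; field; rewrite m0 pi0.
rewrite rpredM //; last first. by rewrite rpredM ?zloc_int.
Qed.

Lemma kernel_walk : pi^-1 *: (z *m W) \is a mxOver (zloc p).
Proof.
have e : b = pi^-1 *: (z *m W) + b *m E *m W.
  rewrite -{1}[b]mulmx1 -(mulVmx uW) eWi mulmxDl mulmxDr !mulmxA; congr (_ + _).
  by rewrite -scalemxAr -!scalemxAl mulmxA ba mul1mx.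
have -> : pi^-1 *: (z *m W) = b - b *m E *m W by rewrite {1}e addrK.
by rewrite rpredB ?mxOverM ?mxOver_rat.
Qed.

Lemma kernel_walk_uniq (v : 'rV[rat]_n) : pi^-1 *: (v *m W) \is a mxOver (zloc p) ->
  exists2 c, c \in zloc p & exists2 v', v' \is a mxOver (zloc p) & v = c *: z + pi *: v'.
Proof.
set r := _ *: _ => rZ; have er : v *m W = pi *: r by rewrite scalerA mulfV // scale1r.
clearbody r; exists ((r *m a) 0 0); first by rewrite mxOver_col ?mxOverM.
exists (r *m E); first by rewrite mxOverM.
have -> : v = (pi *: r) *m invmx W by rewrite -er mulmxK.
rewrite eWi mulmxDr -!scalemxAl -scalemxAr scalerA mulfV // scale1r mulmxA.
by congr (_ + _); rewrite {1}[r *m a]mx11_scalar mul_scalar_mx.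
Qed.

Variable Q0 : 'M[rat]_n.
Hypotheses (Q0Z : Q0 \is a mxOver (zloc p)) (orthQ0 : Q0^T *m Q0 = 1%:M).
Hypotheses (Q0e : Q0 *m rat_mx (onevec n) = rat_mx (onevec n)).
Hypotheses (Q0S : Q0^T *m rat_mx S *m Q0 = rat_mx (- S)).

Lemma reversal_anticomm : rat_mx S *m Q0 = - (Q0 *m rat_mx S).
Proof.
rewrite -mulmxN -rat_mxN -Q0S !mulmxA (mulmx1C orthQ0) mul1mx; exact: erefl.
Qed.

Lemma reversal_walk : Q0 *m W = W *m diag_mx (\row_j (-1) ^+ j).
Proof.
have h k : Q0 *m rat_mx (walk_vec S k) = (-1) ^+ k *: rat_mx (walk_vec S k).
  elim: k => [|k IH]; first by rewrite scale1r.
  rewrite walk_vecS rat_mxM mulmxA -[Q0 *m _]opprK -reversal_anticomm mulNmx -mulmxA IH.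
  by rewrite -scalemxAr exprS mulN1r scaleNr.
apply/matrixP => i j; have /matrixP/(_ i 0) := h j.
rewrite mul_mx_diag !mxE => e; rewrite mulrC -e.
by apply: eq_bigr => k _; rewrite !mxE.
Qed.

(** The left kernel of W modulo p is stable under S, by the companion matrix, and under Q0, by
    [reversal_walk]. So [z] is an eigenvector of both modulo p; anticommutation makes the eigenvalue
    of S vanish, against [isotropic_kernel_not_null]. *)
Lemma reversal_not_integral : (z *m z^T) 0 0 / pi \in zloc p -> False.
Proof.
move=> cZ; have zW := kernel_walk.
have [l lZ [rl rlZ zS]] : exists2 c, c \in zloc p &
    exists2 v', v' \is a mxOver (zloc p) & z *m rat_mx S = c *: z + pi *: v'.
  apply: kernel_walk_uniq.
  rewrite -mulmxA -rat_mxM walk_companion rat_mxM mulmxA scalemxAl mxOverM //.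
  exact: mxOver_rat.
have [m mZ [rm rmZ zQ]] : exists2 c, c \in zloc p &
    exists2 v', v' \is a mxOver (zloc p) & z *m Q0 = c *: z + pi *: v'.
  apply: kernel_walk_uniq.
  rewrite -mulmxA reversal_walk mulmxA scalemxAl mxOverM // mxOver_diag ?rpred0 //.
  by apply/mxOverP => i j; rewrite mxE rpredX // rpredN rpred1.
(* If p divided m, then z = z Q0 Q0^T would vanish modulo p, against z w = 1. *)
have mn : m / pi \notin zloc p.
  apply/negP => mp; have : pi^-1 *: (z *m Q0 *m Q0^T *m w) \is a mxOver (zloc p).
    rewrite zQ !scalemxAl scalerDr !scalerA mulVf // scale1r mulrC.
    by rewrite !mxOverM ?mxOver_tr ?rpredD ?mxOverZ.
  rewrite -[z *m Q0 *m _]mulmxA (mulmx1C orthQ0) mulmx1 zw.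
  by move=> /mxOverP/(_ 0 0); rewrite !mxE mulr1; apply/negP/zloc_invp.
have lp : l / pi \in zloc p.
  apply: (zloc_cancel pp mZ mn); apply: zloc_halve => //.
  (* z S Q0 = - z Q0 S forces 2 l m = 0 modulo p *)
  pose T := (l *: rm + rl *m Q0 + m *: rl + rm *m rat_mx S) *m w.
  have TZ : T 0 0 \in zloc p.
    by rewrite mxOver_col ?mxOverM ?rpredD ?mxOverZ ?mxOverM ?mxOver_rat.
  have e : (2%:R * (m * l)) *: (z *m w) = - pi *: T.
    have : z *m (rat_mx S *m Q0) *m w = - (z *m (Q0 *m rat_mx S) *m w).
      by rewrite reversal_anticomm mulmxN mulNmx.
    rewrite /T !mulmxA zS zQ !mulmxDl -!scalemxAl zS zQ !scalerDr !mulmxDl -!scalemxAl.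
    move=> /matrixP/(_ 0 0) h; apply/matrixP => i j; rewrite !ord1.
    move: h; move: (z *m w) (rm *m w) (rl *m Q0 *m w) (rl *m w) (rm *m rat_mx S *m w).
    by move=> x1 x2 x3 x4 x5; rewrite !mxE => h; nra.
  have := e; rewrite zw => /matrixP/(_ 0 0); rewrite [X in X = _ -> _]mxE.
  rewrite [X in _ = X -> _]mxE mxE mulr1 => ->.
  by rewrite !mulNr rpredN mulrAC mulfV // mul1r.
apply: (isotropic_kernel_not_null cZ).
rewrite zS scalerDr !scalerA mulVf // scale1r mulrC.
by rewrite rpredD ?mxOverZ.
Qed.
End CorankOne.

(** * From local integrality to isomorphism *)

(** Each row has sum 1 and sum of squares 1, so it is a unit vector with entry 1; orthogonality puts
    these entries in different columns. *)
Lemma int_orth_perm n (M : 'M[int]_n) : M *m M^T = 1%:M ->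
  M *m onevec n = onevec n -> exists s : 'S_n, M = perm_mx s.
Proof.
move=> orthM M1.
have rowsum i : \sum_j M i j = 1.
  have /matrixP/(_ i 0) := M1; rewrite !mxE => <-.
  by apply: eq_bigr => j _; rewrite mxE mulr1.
have rowsq i : \sum_j M i j * M i j = 1.
  have /matrixP/(_ i i) := orthM; rewrite !mxE eqxx mulr1n => <-.
  by apply: eq_bigr => j _; rewrite mxE.
(* m^2 >= m on integers, with equality only for 0 and 1 *)
have M01 i j : (M i j == 0) || (M i j == 1).
  have sum0 : \sum_j (M i j * M i j - M i j) = 0 by rewrite sumrB rowsum rowsq subrr.
  have ge0 k : true -> 0 <= M i k * M i k - M i k by move=> _; nia.
  have /eqP := psumr_eq0P ge0 sum0 isT (i := j).
  by rewrite -[X in _ - X]mulr1 -mulrBr mulf_eq0 subr_eq0.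
have Mge0 i j : 0 <= M i j by case/orP: (M01 i j) => /eqP ->.
have ex1 i : exists j, M i j == 1.
  apply/existsP; apply: contraT; rewrite negb_exists => /forallP h.
  have := rowsum i; rewrite big1 // => j _.
  by case/orP: (M01 i j) => /eqP // e; have := h j; rewrite e.
pose f i := xchoose (ex1 i).
have Mf i : M i (f i) = 1 by apply/eqP; exact: (xchooseP (ex1 i)).
have f_inj : injective f.
  move=> i i' eqf; apply/eqP; apply: contraT => ii'.
  have /matrixP/(_ i i') := orthM; rewrite !mxE (negPf ii') => h.
  have ge0 k : true -> 0 <= M i k * M^T k i' by rewrite mxE mulr_ge0.
  have := psumr_eq0P ge0 h isT (i := f i); rewrite mxE Mf eqf Mf => /eqP.
  by rewrite mulr1 oner_eq0.
exists (perm f_inj); apply/matrixP => i j; rewrite !mxE permE.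
have [<-|fij] := eqVneq (f i) j; first exact: Mf.
have := rowsum i; rewrite (bigD1 (f i)) //= Mf => /eqP.
rewrite addrC -subr_eq0 addrK => /eqP h.
by apply: (psumr_eq0P _ h) => // ; rewrite eq_sym.
Qed.

Lemma local_orth_oriso n (D1 D2 : 'M[int]_n) (R : 'M[rat]_n) :
  (forall p, prime p -> R \is a mxOver (zloc p)) -> R *m R^T = 1%:M ->
  R *m rat_mx (onevec n) = rat_mx (onevec n) ->
  R^T *m rat_mx D1 *m R = rat_mx D2 -> oriso D1 D2.
Proof.
move=> locR orthR R1 RD.
have eR : R = rat_mx (map_mx numq R).
  apply/matrixP => i j; rewrite !mxE.
  have d1 : denq (R i j) = 1.
    by apply: zloc_all_int => p pp; have /mxOverP := locR p pp; apply.
  by rewrite numqE d1 mulr1.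
move: {eR} (map_mx numq R) eR => M eR; subst R.
have [|| s eM] := @int_orth_perm n M.
- by apply: rat_mx_inj; rewrite rat_mxM rat_mx_tr orthR /rat_mx map_mx1.
- by apply: rat_mx_inj; rewrite rat_mxM R1.
exists s; rewrite -eM; apply: rat_mx_inj.
by rewrite !rat_mxM rat_mx_tr RD.
Qed.

Lemma oriented_skewsym n (S : 'M[int]_n) : oriented_graph S -> skewsym S.
Proof. by move=> oS; apply/matrixP => i j; rewrite !mxE; case: (oS i j). Qed.

Lemma in_Gn_det_neq0 n (S : 'M[int]_n) : in_Gn S -> \det (walk_mx S) != 0.
Proof.
case=> q [-> [oq _]]; rewrite mulf_neq0 ?pnatr_eq0 ?expn_eq0 //.
by apply: contraTneq oq => ->.
Qed.

Lemma in_Gn_squarefree n (S : 'M[int]_n) p : in_Gn S -> prime p -> odd p ->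
  ~~ ((p ^ 2)%N %| \det (walk_mx S))%Z.
Proof.
case=> q [-> [oq sq]] pp po; apply: contra (sq _ (prime_gt1 pp)).
rewrite dvdzE abszM /= natz absz_nat Gauss_dvdl // coprimeXl // coprimeXr //.
by rewrite coprimen2.
Qed.

(** * Transfer matrices of cospectral graphs, prime by prime *)

Section Mates.
Variables (n : nat) (S : 'M[int]_n).
Hypotheses (skS : skewsym S) (GnS : in_Gn S).
Let detS : \det (walk_mx S) != 0. Proof. exact: in_Gn_det_neq0. Qed.

Definition cospectral_skew (D : 'M[int]_n) := skewsym D /\ gen_cospectral S D.

Lemma cospectral_walk_count D : cospectral_skew D ->
  forall k, walk_count S k = walk_count D k.
Proof. by case=> skD cD k; exact: gen_cospectral_walk_count. Qed.

Lemma transfer_local_coprime D p : prime p -> ~~ (p %| \det (walk_mx S))%Z ->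
  transfer S D \is a mxOver (zloc p).
Proof.
move=> pp npd; rewrite mxOverM ?mxOver_rat // mxOver_inv ?mxOver_rat ?rat_walk_unit //.
by rewrite det_rat_mx zlocV_int // prime_coprime.
Qed.

(** The row [z] comes from W(S)^-1 alone, so both transfer matrices share it and [orth_rank1_pair]
    applies. *)
Lemma transfer_pair_local D1 D2 p : cospectral_skew D1 -> cospectral_skew D2 ->
  prime p -> odd p -> transfer S D1 \isn't a mxOver (zloc p) ->
  transfer S D2 \isn't a mxOver (zloc p) ->
  transfer S D1 *m (transfer S D2)^T \is a mxOver (zloc p).
Proof.
move=> c1 c2 pp po n1 n2.
have pd : (p %| \det (walk_mx S))%Z.
  by apply: contraNT n1; exact: transfer_local_coprime.
have [a [w [z [b [E [[aZ wZ zZ bZ EZ] eWi ba zw]]]]]] :=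
  corank1_inverse pp pd (in_Gn_squarefree GnS pp po).
have e D : transfer S D = p%:R^-1 *: (rat_mx (walk_mx D) *m a *m z) + rat_mx (walk_mx D) *m E.
  by rewrite /transfer eWi mulmxDr -scalemxAr mulmxA.
apply: (orth_rank1_pair pp po _ _ zZ _ _ (e D1) (e D2)) => //;
  rewrite ?mxOverM ?mxOver_rat //; apply: transfer_orthr => //; first [exact: c1.1|exact: c2.1|exact: cospectral_walk_count].
Qed.

(** At 2 integrality is automatic. At an odd p, a non-integral transfer matrix forces p to divide
    \det W(S) and [z] to be isotropic modulo p, which [reversal_not_integral] excludes. *)
Lemma transfer_local_of_reversal D p (Q0 : 'M[rat]_n) : cospectral_skew D ->
  prime p -> reg_rat_orth Q0 -> Q0^T *m rat_mx S *m Q0 = rat_mx (- S) ->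
  Q0 \is a mxOver (zloc p) -> transfer S D \is a mxOver (zloc p).
Proof.
move=> cD pp [orthQ0 Q0e] Q0S Q0Z.
have [p2|po] := even_prime pp.
  case: GnS => q [dq [oq _]]; rewrite p2.
  by apply: (transfer_zloc2 skS cD.1 cD.2.1 dq oq).
apply: contraT => nD.
have pd : (p %| \det (walk_mx S))%Z.
  by apply: contraNT nD; exact: transfer_local_coprime.
have p2d := in_Gn_squarefree GnS pp po.
have [a [w [z [b [E [[aZ wZ zZ bZ EZ] eWi ba zw]]]]]] := corank1_inverse pp pd p2d.
have e : transfer S D = p%:R^-1 *: (rat_mx (walk_mx D) *m a *m z) + rat_mx (walk_mx D) *m E.
  by rewrite /transfer eWi mulmxDr -scalemxAr mulmxA.
have yZ : rat_mx (walk_mx D) *m a \is a mxOver (zloc p) by rewrite mxOverM ?mxOver_rat.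
have FZ : rat_mx (walk_mx D) *m E \is a mxOver (zloc p) by rewrite mxOverM ?mxOver_rat.
have oD : transfer S D *m (transfer S D)^T = 1%:M.
  by apply: transfer_orthr => //; [exact: cD.1 | exact: cospectral_walk_count].
have [cZ _] := orth_rank1_relation pp yZ zZ FZ e oD nD.
by case: (reversal_not_integral pp po skS detS pd p2d aZ wZ zZ bZ EZ eWi ba zw Q0Z orthQ0 Q0e Q0S cZ).
Qed.

Lemma transfer_conj D : cospectral_skew D ->
  (transfer S D)^T *m rat_mx D *m transfer S D = rat_mx S /\
  transfer S D *m rat_mx S *m (transfer S D)^T = rat_mx D.
Proof.
move=> cD; have h := cospectral_walk_count cD.
have o1 := transfer_orth skS cD.1 h detS.
have o2 := transfer_orthr skS cD.1 h detS.
have sim := transfer_similar skS cD.1 h detS.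
by rewrite -mulmxA -sim mulmxA o1 mul1mx sim -mulmxA o2 mulmx1.
Qed.

Lemma local_transfer_oriso D : cospectral_skew D ->
  (forall p, prime p -> transfer S D \is a mxOver (zloc p)) -> oriso S D.
Proof.
move=> cD loc; have o1 := transfer_orth skS cD.1 (cospectral_walk_count cD) detS.
apply: (local_orth_oriso (R := (transfer S D)^T)) => [p pp|||].
- by rewrite mxOver_tr loc.
- by rewrite trmxK o1.
- by rewrite -{1}(transfer_ones D detS) mulmxA o1 mul1mx.
- by rewrite trmxK; case: (transfer_conj cD).
Qed.

Lemma local_transfer_pair_oriso D1 D2 : cospectral_skew D1 -> cospectral_skew D2 ->
  (forall p, prime p -> transfer S D1 *m (transfer S D2)^T \is a mxOver (zloc p)) ->
  oriso D1 D2.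
Proof.
move=> c1 c2 loc; have h1 := cospectral_walk_count c1; have h2 := cospectral_walk_count c2.
have o1 := transfer_orth skS c1.1 h1 detS; have o2 := transfer_orth skS c2.1 h2 detS.
have [e1 _] := transfer_conj c1; have [_ e2] := transfer_conj c2.
have u1 := transfer_ones D1 detS; have u2 := transfer_ones D2 detS.
move: (transfer S D1) (transfer S D2) loc o1 o2 e1 e2 u1 u2 => P1 P2 loc o1 o2 e1 e2 u1 u2.
apply: (local_orth_oriso loc).
- by rewrite trmx_mul trmxK mulmxA -(mulmxA P1) o2 mulmx1; apply/mulmx1C.
- by rewrite -mulmxA -{1}u2 (mulmxA _ P2) o2 mul1mx u1.
- rewrite trmx_mul trmxK -e2 -e1 !mulmxA; exact: erefl.
Qed.

End Mates.

(** * Counting mates by their sets of bad primes *)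

Lemma level_local n (Q : 'M[rat]_n) ps p : all prime ps -> prime p -> p \notin ps ->
  is_level Q (\prod_(r <- ps) r)%N -> Q \is a mxOver (zloc p).
Proof.
move=> pps pp nps [_ [[M eM] _]]; apply/mxOverP => i j; apply/zlocP.
exists (\prod_(r <- ps) r)%N%:Z, (M i j); split; last first.
  by have /matrixP/(_ i j) := eM; rewrite !mxE mulrC => <-.
rewrite absz_nat; elim: ps pps nps {eM} => [|r ps IH] /=; first by rewrite big_nil coprimen1.
move=> /andP[pr pps]; rewrite inE negb_or => /andP[nr nps].
by rewrite big_cons coprimeMr IH // andbT prime_coprime // dvdn_prime2.
Qed.
Unset Implicit Arguments.

(* "up to isomorphism, at most 2^t - 1 mates": every family of pairwise
   non-isomorphic generalized cospectral mates has at most 2^t - 1 members. *)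
Theorem theorem1p3 (n : nat) (S : 'M[int]_n) (Q0 : 'M[rat]_n)
  (ps : seq nat) (mates : seq 'M[int]_n) :
  oriented_graph S -> in_Gn S ->
  reg_rat_orth Q0 -> Q0^T *m rat_mx S *m Q0 = rat_mx (- S) ->
  uniq ps -> all prime ps -> all odd ps ->
  is_level Q0 (\prod_(p <- ps) p)%N ->
  (forall D, D \in mates -> gc_mate S D) ->
  (forall i j : nat, (i < size mates)%N -> (j < size mates)%N -> i != j ->
     ~ oriso (nth 0 mates i) (nth 0 mates j)) ->
  (size mates <= 2 ^ size ps - 1)%N.
Proof.
move=> oS GnS regQ0 Q0S _ pps ops levQ0 matesP noniso.
have skS := oriented_skewsym oS.
pose mate i := nth 0 mates i.
have cosp (i : 'I_(size mates)) : cospectral_skew S (mate i).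
  have [oD [cD _]] := matesP _ (mem_nth 0 (ltn_ord i)).
  by split=> //; exact: oriented_skewsym.
have off_ps (i : 'I_(size mates)) p : prime p -> p \notin ps ->
    transfer S (mate i) \is a mxOver (zloc p).
  move=> pp nps; apply: (transfer_local_of_reversal skS GnS (cosp i) pp regQ0 Q0S).
  exact: level_local levQ0.
pose bad (i : 'I_(size mates)) : {set 'I_(size ps)} :=
  [set k : 'I_(size ps) | transfer S (mate i) \isn't a mxOver (zloc (nth 0%N ps k))].
have badP i p : p \in ps -> exists2 k : 'I_(size ps), nth 0%N ps k = p &
    (k \in bad i) = (transfer S (mate i) \isn't a mxOver (zloc p)).
  move=> pps'; have kp : (index p ps < size ps)%N by rewrite index_mem.
  by exists (Ordinal kp); rewrite ?inE /= nth_index.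
(* An empty bad set makes the transfer matrix integral at every prime, so the mate would be
   isomorphic to S. *)
have bad_n0 i : bad i != set0.
  apply/eqP => bad0; have [_ [_ niso]] := matesP _ (mem_nth 0 (ltn_ord i)).
  apply: niso; apply: (local_transfer_oriso skS GnS (cosp i)) => p pp.
  have [pin|pnin] := boolP (p \in ps); last exact: off_ps.
  by have [k _] := badP i p pin; rewrite bad0 inE => /esym/negbFE.
(* With equal bad sets, at each prime both transfer matrices are integral or both are not; in either
   case P_i P_j^T is integral there, so the two mates would be isomorphic. *)
have bad_inj : injective bad.
  move=> i j eqb; apply/val_inj/eqP; apply: contraT => ij.
  case: (noniso i j (ltn_ord i) (ltn_ord j) ij).
  apply: (local_transfer_pair_oriso skS GnS (cosp i) (cosp j)) => p pp.
  have [pin|pnin] := boolP (p \in ps); last by rewrite mxOverM ?mxOver_tr ?off_ps.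
  have [k kp ki] := badP i p pin; have [k' kp' kj] := badP j p pin.
  have [bi|gi] := boolP (transfer S (mate i) \is a mxOver (zloc p)).
    rewrite mxOverM // mxOver_tr; apply: contraT => bj.
    move: kj; rewrite bj -eqb inE kp' => /negP; by case.
  apply: transfer_pair_local => //; first by have /allP := ops; apply.
  by move: ki; rewrite gi eqb inE kp.
(* There remain the nonempty subsets of a set with t elements. *)
have /subset_leq_card : bad @: setT \subset powerset setT :\ set0.
  apply/subsetP => A /imsetP[i _ ->]; rewrite !inE bad_n0; exact: subsetT.
rewrite card_imset // cardsT card_ord => /leq_trans; apply.
have := cardsD1 set0 (powerset [set: 'I_(size ps)]).
by rewrite card_powerset cardsT card_ord powersetE sub0set add1n => ->; rewrite subn1.
Qed.
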